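(* For all integers $n,m\ge 1$ with $n-1\le m\le \binom n2$, $$\tilde{r}(\mathcal C_{\mathrm{odd}},\mathcal{C}on_{n,m})\ge \varphi n + m-2\varphi+1,$$ where $\varphi=(1+\sqrt5)/2$ is the golden ratio.
   Context: Given nonempty families $\mathcal H_1,\mathcal H_2$ of finite graphs, the online size Ramsey game $\mathcal R(\mathcal H_1,\mathcal H_2)$ is played on the edge set of the infinite complete graph $K_{\mathbb N}$: in each round Builder selects a previously unselected edge and Painter colours it red or blue. The game ends as soon as, after Painter's move, there is a red copy of some graph in $\mathcal H_1$ or a blue copy of some graph in $\mathcal H_2$. Builder tries to end the game as soon as possible, Painter tries to delay it. The online size Ramsey number $\tilde r(\mathcal H_1,\mathcal H_2)$ is the number of rounds the game lasts when both players play optimally (for single graphs $H_i$ one writes $\tilde r(H_1,H_2)$). Here $\mathcal C_{\mathrm{odd}}$ is the family of all odd cycles and $\mathcal{C}on_{n,m}$ is the family of all connected graphs with exactly $n$ vertices and at least $m$ edges. *)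

(* Defs.v *)
From mathcomp Require Import all_boot.
From Stdlib Require Import Reals.

Set Implicit Arguments.
Unset Strict Implicit.
Unset Printing Implicit Defensive.

Record fgraph := FGraph { fv : nat; fadj : rel 'I_fv }.
Arguments fadj : clear implicits.

Definition simple_graph (G : fgraph) : Prop :=
  symmetric (fadj G) /\ irreflexive (fadj G).

Definition graph_iso (G H : fgraph) : Prop :=
  exists f : 'I_(fv G) -> 'I_(fv H),
    bijective f /\ forall i j, fadj H (f i) (f j) = fadj G i j.

Definition cycle_graph (l : nat) : fgraph :=
  @FGraph l (fun i j : 'I_l => (val j == (val i).+1 %% l) || (val i == (val j).+1 %% l)).

Definition num_edges (G : fgraph) : nat :=
  #|[set p : 'I_(fv G) * 'I_(fv G) | (val p.1 < val p.2) && fadj G p.1 p.2]|.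

Definition connected_graph (G : fgraph) : Prop :=
  forall i j : 'I_(fv G), connect (fadj G) i j.

Definition C_odd (H : fgraph) : Prop :=
  simple_graph H /\ exists l, 3 <= l /\ odd l /\ graph_iso H (cycle_graph l).

Definition Con (n m : nat) (H : fgraph) : Prop :=
  simple_graph H /\ fv H = n /\ connected_graph H /\ m <= num_edges H.

(* A position: the list of selected edges of K_N with their colours.
   An edge {u,v} (u <> v) is stored as the pair (minn u v, maxn u v);
   colour true = red, false = blue. *)
Definition position := seq ((nat * nat) * bool).

Definition host_adj (c : bool) (s : position) (u v : nat) : bool :=
  ((minn u v, maxn u v), c) \in s.

Definition has_copy (c : bool) (s : position) (H : fgraph) : Prop :=
  exists f : 'I_(fv H) -> nat,
    injective f /\ forall i j, fadj H i j -> host_adj c s (f i) (f j).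

Definition game_over (H1 H2 : fgraph -> Prop) (s : position) : Prop :=
  (exists H, H1 H /\ has_copy true s H) \/ (exists H, H2 H /\ has_copy false s H).

Fixpoint builder_wins_within (H1 H2 : fgraph -> Prop) (t : nat) (s : position)
  : Prop :=
  game_over H1 H2 s \/
  match t with
  | 0 => False
  | t'.+1 =>
      exists u v : nat, u < v /\ (forall c, ((u, v), c) \notin s) /\
        forall c : bool, builder_wins_within H1 H2 t' (((u, v), c) :: s)
  end.

(* r~(H1,H2) = least t such that Builder can force the end within t rounds
   from the empty position (+infinity if no such t).
   online_ramsey_ge H1 H2 x  <->  r~(H1,H2) >= x. *)
Definition online_ramsey_ge (H1 H2 : fgraph -> Prop) (x : R) : Prop :=
  forall t : nat, builder_wins_within H1 H2 t [::] -> (x <= INR t)%R.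

Definition golden_ratio : R := ((1 + sqrt 5) / 2)%R.

(* Main.v *)
Require Import Defs.
From mathcomp Require Import all_boot.
From Stdlib Require Import Reals Lra.

Set Implicit Arguments.
Unset Strict Implicit.
Unset Printing Implicit Defensive.

(** Painter keeps every connected component of the selected graph split into
    two sides, with the red edges going across and the blue edges staying inside
    a side; then no red odd cycle ever appears, and Painter has a choice only
    when an edge merges two components.  Call an edge of a component wasted for
    a side [A] if it is not a blue edge inside [A], and let the deficit of [A] be
    [phi |A| - (number of edges wasted for A)].  Let components have deficits
    [(p, q)] and [(s, t)], and let the merging edge join the sides with deficits
    [p] and [s].  A blue edge gives deficits [(p + s, q + t - 1)], a red one
    [(p + t - 1, q + s - 1)].  An isolated vertex has deficits [(phi, 0)].  One of
    the two colours always leads to the convex region [safe] below, whose points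
    have both coordinates at most [2 phi - 1].  Hence a blue connected graph with
    [n] vertices comes with at least [phi n - 2 phi + 1] wasted edges. *)

(** * The region of admissible deficits *)

Local Open Scope R_scope.

Lemma golden_ratio_sqr : golden_ratio * golden_ratio = golden_ratio + 1.
Proof.
have h5 : sqrt 5 * sqrt 5 = 5 by apply: sqrt_sqrt; lra.
rewrite /golden_ratio; lra.
Qed.

Lemma golden_ratio_bounds : 1.6 < golden_ratio < 1.7.
Proof.
have h5 : sqrt 5 * sqrt 5 = 5 by apply: sqrt_sqrt; lra.
have h0 := sqrt_pos 5.
rewrite /golden_ratio; split; nra.
Qed.

Definition safe (p q : R) : Prop :=
  [/\ p <= 2 * golden_ratio - 1, q <= 2 * golden_ratio - 1,
      p + golden_ratio * q <= golden_ratio & golden_ratio * p + q <= golden_ratio].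

(** The deficits [(phi, 0)] of an isolated vertex violate [phi p + q <= phi], so this point is
    adjoined separately. *)
Definition admissible (p q : R) : Prop :=
  (p = golden_ratio /\ q = 0) \/ safe p q.

Lemma admissible_le p q : admissible p q ->
  p <= 2 * golden_ratio - 1 /\ q <= 2 * golden_ratio - 1.
Proof.
have := golden_ratio_bounds.
by case=> [? ?] [[-> ->] | [? ? _ _]]; split; lra.
Qed.

Lemma safeC p q : safe p q -> safe q p.
Proof. by case=> *; split=> //; lra. Qed.

(** Red preserves both oblique inequalities, so it fails only at the cap, when [q > phi]. Then
    [p + phi q <= phi] forces [p < -1], which leaves room for blue to add [phi] to [p]. *)
Lemma safe_merge_single p q : safe p q ->
  safe (p + golden_ratio) (q + 0 - 1) \/ safe (p + 0 - 1) (q + golden_ratio - 1).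
Proof.
have g2 := golden_ratio_sqr; have [g0 g1] := golden_ratio_bounds.
case=> h1 h2 h3 h4; case: (Rle_dec q golden_ratio) => hq.
  by right; split; lra.
left; have hq' : golden_ratio * golden_ratio < golden_ratio * q by nra.
have hp : golden_ratio * (p + golden_ratio * q) <= golden_ratio * golden_ratio by nra.
by split; nra.
Qed.

(** Red can fail only at a cap, say [p + t > 2 phi]. As no coordinate exceeds [2 phi - 1], both [p]
    and [t] exceed 1, so the oblique inequalities make [q] and [s] negative. Blue then pairs each
    large coordinate with a negative one. *)
Lemma safe_merge p q s t : safe p q -> safe s t ->
  safe (p + s) (q + t - 1) \/ safe (p + t - 1) (q + s - 1).
Proof.
have g2 := golden_ratio_sqr; have [g0 g1] := golden_ratio_bounds.
case=> h1 h2 h3 h4 [k1 k2 k3 k4].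
case: (Rle_dec (p + t) (2 * golden_ratio)) => hpt; last first.
  have hg : 0 < golden_ratio * (p + t - 2 * golden_ratio) by nra.
  by left; split; nra.
case: (Rle_dec (q + s) (2 * golden_ratio)) => hqs; last first.
  have hg : 0 < golden_ratio * (q + s - 2 * golden_ratio) by nra.
  by left; split; nra.
by right; split; nra.
Qed.

Lemma admissible_merge p q s t : admissible p q -> admissible s t ->
  safe (p + s) (q + t - 1) \/ safe (p + t - 1) (q + s - 1).
Proof.
have g2 := golden_ratio_sqr; have [g0 g1] := golden_ratio_bounds.
case=> [[-> ->]|S1] [[-> ->]|S2].
(* Red yields [(phi - 1, phi - 1)], the corner where both oblique inequalities are equalities; blue
   would give [2 phi], above the cap. *)
- by right; split; nra.
- case: (safe_merge_single S2) => S; [left | right; apply: safeC].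
    by rewrite [_ + s]Rplus_comm [0 + t]Rplus_comm.
  by rewrite [_ + t]Rplus_comm [0 + s]Rplus_comm.
- exact: safe_merge_single.
- exact: safe_merge.
Qed.

Local Close Scope R_scope.

(* Every edge of a position inside the component [k] has both ends labelled [k],
   so it is enough to look at its first end. *)
Definition waste (comp : nat -> nat) (side : nat -> bool) (s : position)
    (k : nat) (b : bool) : nat :=
  count (fun e => (comp e.1.1 == k) && (e.2 || (side e.1.1 != b))) s.

(* [comp] labels the components, [side] the two sides of each, and [D k b] is an
   upper bound for the deficit of side [b] of component [k]. *)
Record painter_inv (s : position) (comp : nat -> nat) (side : nat -> bool)
    (D : nat -> bool -> R) : Prop := PainterInv {
  inv_edge : forall u v c, ((u, v), c) \in s ->
    comp u = comp v /\ c = side u (+) side v;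
  inv_deficit : forall w b (T : seq nat), uniq T ->
    (forall x, x \in T -> comp x = comp w /\ side x = b) ->
    (golden_ratio * INR (size T) - INR (waste comp side s (comp w) b)
      <= D (comp w) b)%R;
  inv_admissible : forall w,
    admissible (D (comp w) (side w)) (D (comp w) (~~ side w))
}.

Lemma painter_inv_nil :
  painter_inv [::] (fun w => w) xpredT (fun _ b => if b then golden_ratio else 0%R).
Proof.
have [g0 g1] := golden_ratio_bounds.
split=> //=; last by move=> w; left.
move=> w b T uT hT.
have szT : size T <= b.
  case: b hT => hT.
    have := @uniq_leq_size _ T [:: w] uT; apply.
    by move=> x /hT [-> _]; rewrite inE.
  by case: T {uT} hT => // x T /(_ x (mem_head _ _)) [].
by case: b szT {hT}; case: (size T) => [|[|?]] //= _; lra.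
Qed.

(** The colour is forced, and an extra edge can only increase the waste, so the old bounds [D]
    survive. *)
Lemma painter_inv_same s comp side D u v :
  painter_inv s comp side D -> comp u = comp v ->
  painter_inv (((u, v), side u (+) side v) :: s) comp side D.
Proof.
case=> hE hD hA euv; split=> //.
  move=> x y c; rewrite inE => /orP [/eqP [-> -> ->] //|]; exact: hE.
move=> w b T uT hT; apply: Rle_trans (hD w b T uT hT).
have /leP/le_INR : waste comp side s (comp w) b
    <= waste comp side (((u, v), side u (+) side v) :: s) (comp w) b.
  exact: leq_addl.
lra.
Qed.

(** * Merging two components *)

Section Merge.

Variables (s : position) (comp : nat -> nat) (side : nat -> bool).
Variables (D : nat -> bool -> R) (u v : nat) (c : bool).
Hypothesis inv_s : painter_inv s comp side D.
Hypothesis neq_uv : comp u != comp v.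

(** Tells whether the two sides of the component of [v] must be swapped so that the new edge goes
    across exactly when it is red. *)
Let flip := side u (+) side v (+) c.

Definition merge_comp w := if comp w == comp v then comp u else comp w.
Definition merge_side w := if comp w == comp v then side w (+) flip else side w.
(** The subtracted term is the new edge itself, wasted for [b] unless it is blue inside that
    side. *)
Definition merge_deficit k b : R :=
  if k == comp u then
    (D (comp u) b + D (comp v) (b (+) flip)
      - INR (c || (side u != b)))%R
  else D k b.

Let comp_u : merge_comp u = comp u.
Proof. by rewrite /merge_comp (negbTE neq_uv). Qed.

Let side_u : merge_side u = side u.
Proof. by rewrite /merge_side (negbTE neq_uv). Qed.

Lemma merge_waste_merged b :
  waste merge_comp merge_side (((u, v), c) :: s) (comp u) b =
  (c || (side u != b)) + (waste comp side s (comp u) b +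
     waste comp side s (comp v) (b (+) flip)).
Proof.
rewrite /waste /= comp_u side_u eqxx /=; congr (_ + _).
elim: s => //= e r ->; rewrite addnACA; congr (_ + _).
rewrite /merge_comp /merge_side.
case: (eqVneq (comp e.1.1) (comp v)) => [->|ne].
  rewrite [comp v == comp u]eq_sym (negbTE neq_uv) !eqxx /= add0n.
  by congr (nat_of_bool (_ || ~~ _)); case: (side _) (flip) b => [] [] [].
by rewrite addn0.
Qed.

Lemma merge_waste_other k b : k != comp u -> k != comp v ->
  waste comp side s k b <= waste merge_comp merge_side (((u, v), c) :: s) k b.
Proof.
move=> ku kv; apply: leq_trans (leq_addl _ _).
apply: sub_count => e /andP [/eqP ek he].
by rewrite /merge_comp /merge_side ek (negbTE kv) eqxx.
Qed.

Lemma merge_deficitP w b (T : seq nat) : uniq T ->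
  (forall x, x \in T -> merge_comp x = merge_comp w /\ merge_side x = b) ->
  (golden_ratio * INR (size T)
    - INR (waste merge_comp merge_side (((u, v), c) :: s) (merge_comp w) b)
    <= merge_deficit (merge_comp w) b)%R.
Proof.
move=> uT hT; have [_ hD _] := inv_s.
rewrite /merge_deficit; case: (eqVneq (merge_comp w) (comp u)) => [ew | nw].
  rewrite ew merge_waste_merged.
  (* [T] splits according to the two old components, and the old bounds are added. *)
  have h1 := hD u b [seq x <- T | comp x == comp u] (filter_uniq _ uT).
  have h2 := hD v (b (+) flip) [seq x <- T | comp x != comp u] (filter_uniq _ uT).
  have -> : size T = size [seq x <- T | comp x == comp u]
      + size [seq x <- T | comp x != comp u].
    by rewrite !size_filter -(count_predC (fun x => comp x == comp u)).
  rewrite !plus_INR.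
  have /h1 {}h1 : forall x, x \in [seq x <- T | comp x == comp u] ->
      comp x = comp u /\ side x = b.
    move=> x; rewrite mem_filter => /andP [/eqP xu /hT [_]].
    by rewrite /merge_side xu (negbTE neq_uv).
  have /h2 {}h2 : forall x, x \in [seq x <- T | comp x != comp u] ->
      comp x = comp v /\ side x = b (+) flip.
    move=> x; rewrite mem_filter => /andP [xu /hT []].
    rewrite ew /merge_comp /merge_side.
    case: (eqVneq (comp x) (comp v)) => [-> _ <-|_ xu']; first by rewrite addbK.
    by rewrite xu' eqxx in xu.
  lra.
have ew : merge_comp w = comp w.
  by move: nw; rewrite /merge_comp; case: ifP => //; rewrite eqxx.
have nv : comp w != comp v.
  by apply/negP=> e; move: nw; rewrite /merge_comp e eqxx.
have {}hT x : x \in T -> comp x = comp w /\ side x = b.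
  move=> /hT []; rewrite ew /merge_comp /merge_side; case: ifP => // _ e.
  by move: nw; rewrite ew e eqxx.
rewrite ew in nw *.
have /leP/le_INR := merge_waste_other b nw nv.
have := hD w b T uT hT; lra.
Qed.

Lemma painter_inv_merge :
  safe (merge_deficit (comp u) (side u)) (merge_deficit (comp u) (~~ side u)) ->
  painter_inv (((u, v), c) :: s) merge_comp merge_side merge_deficit.
Proof.
move=> S; have [hE _ hA] := inv_s.
split; last 1 first.
- move=> w; case: (eqVneq (merge_comp w) (comp u)) => [->|nw].
    right; case: (eqVneq (merge_side w) (side u)) => [-> //|].
    by case: (merge_side w) (side u) S => [] [] // /safeC.
  have nv : (comp w == comp v) = false.
    by apply/negP=> e; move: nw; rewrite /merge_comp e eqxx.
  move: nw; rewrite /merge_deficit /merge_comp /merge_side nv => /negbTE ->.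
  exact: hA.
- move=> x y d; rewrite inE => /orP [/eqP [-> -> ->]|].
    rewrite comp_u side_u /merge_comp /merge_side eqxx /flip; split=> //.
    by case: (side u) (side v) c => [] [] [].
  move=> /hE [exy ->]; rewrite /merge_comp /merge_side exy; split=> //.
  by case: ifP => // _; case: (side x) (side y) flip => [] [] [].
- exact: merge_deficitP.
Qed.

End Merge.

Lemma painter_move s comp side D u v : painter_inv s comp side D ->
  exists c comp' side' D', painter_inv (((u, v), c) :: s) comp' side' D'.
Proof.
move=> I; case: (eqVneq (comp u) (comp v)) => [euv | nuv].
  by exists (side u (+) side v), comp, side, D; apply: painter_inv_same.
have := admissible_merge (inv_admissible I u) (inv_admissible I v).
(* The first alternative is the outcome of a blue edge, the second that of a red one. *)
case=> S; [exists false | exists true]; do 3 eexists;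
  apply: (painter_inv_merge I nuv); move: S;
  rewrite /merge_deficit eqxx; case: (side u); case: (side v) => /=;
  by rewrite ?Rminus_0_r.
Qed.

(** * Monochromatic copies under the invariant *)

Lemma painter_host_adj s comp side D c x y : painter_inv s comp side D ->
  host_adj c s x y -> comp x = comp y /\ c = side x (+) side y.
Proof.
case=> hE _ _; rewrite /host_adj.
case: (leqP x y) => h; first exact: hE.
by move=> /hE [-> ->]; rewrite addbC.
Qed.

Lemma no_red_odd_cycle s comp side D H :
  painter_inv s comp side D -> C_odd H -> ~ has_copy true s H.
Proof.
move=> I [_ [l [l3 [ol [f [[g fK gK] hf]]]]]] [h [_ hh]].
case: l l3 ol f g fK gK hf => // l l3 ol f g fK gK hf.
(* The side of the [k]-th vertex along the cycle; it alternates because red edges go across. The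
   cycle now has length [l.+1], so [l] is even. *)
pose tau k := side (h (g (inord k))).
have adj i j : j == i.+1 %% l.+1 -> i < l.+1 -> j < l.+1 -> tau j = ~~ tau i.
  move=> ij il jl.
  have /hh/(painter_host_adj I) [_] : fadj H (g (inord i)) (g (inord j)).
    by rewrite -hf !gK /= !inordK // ij.
  by rewrite -/(tau i) -/(tau j); case: (tau i) (tau j) => [] [].
have tauE k : k < l.+1 -> tau k = tau 0 (+) odd k.
  elim: k => [|k IHk] kl; first by rewrite addbF.
  by rewrite (adj k) ?modn_small // ?IHk ?(ltnW kl) //= addbN.
(* The closing edge requires [tau 0] and [tau l] to differ, whereas [l] even makes them equal. *)
have := adj l 0; rewrite modnn (tauE l) // => /(_ isT (ltnSn l) isT).
by move: ol => /= /negbTE ->; case: (tau 0).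
Qed.

Lemma blue_copy_in_side s comp side D H (f : 'I_(fv H) -> nat) i j :
  painter_inv s comp side D ->
  (forall i j, fadj H i j -> host_adj false s (f i) (f j)) ->
  connect (fadj H) i j -> comp (f j) = comp (f i) /\ side (f j) = side (f i).
Proof.
move=> I hf /connectP [p hp ->] {j}; elim: p i hp => //= x p IHp i.
move=> /andP [/hf/(painter_host_adj I) [-> e] /IHp [-> ->]]; split=> //.
by move: e; case: (side (f i)) (side (f x)) => [] [].
Qed.

(** The edges of a connected blue copy all lie inside one side, so none of them is wasted for it:
    wasted edges and copy edges are disjoint parts of [s]. *)
Lemma blue_copy_size s comp side D H (f : 'I_(fv H) -> nat) i0 :
  painter_inv s comp side D -> injective f ->
  (forall i j, fadj H i j -> host_adj false s (f i) (f j)) ->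
  connected_graph H ->
  waste comp side s (comp (f i0)) (side (f i0)) + num_edges H <= size s.
Proof.
move=> I injf hf cH.
rewrite /waste -(count_predC (fun e => (comp e.1.1 == comp (f i0)) &&
  (e.2 || (side e.1.1 != side (f i0)))) s) leq_add2l -size_filter.
pose edge (p : 'I_(fv H) * 'I_(fv H)) :=
  ((minn (f p.1) (f p.2), maxn (f p.1) (f p.2)), false).
rewrite /num_edges; set E := [set _ | _].
have uE : uniq [seq edge p | p in E].
  rewrite map_inj_in_uniq ?enum_uniq // => -[a b] [a' b'].
  rewrite !mem_enum !inE /= => /andP [ab _] /andP [ab' _] [].
  (* The two mixed cases would match the ends crosswise, contradicting [a < b] and [a' < b']. *)
  case: (leqP (f a) (f b)) => h1; case: (leqP (f a') (f b')) => h2.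
  - by move=> /injf -> /injf ->.
  - move=> /injf ea /injf eb; subst a' b'.
    by move: (ltn_trans ab ab'); rewrite ltnn.
  - move=> /injf ea /injf eb; subst a' b'.
    by move: (ltn_trans ab ab'); rewrite ltnn.
  - by move=> /injf -> /injf ->.
rewrite cardE -(size_map edge); apply: uniq_leq_size uE _ => e.
move=> /mapP [[a b]]; rewrite mem_enum inE /= => /andP [_ /hf hab] ->.
rewrite mem_filter /= [_ \in s]hab andbT.
have [ca sa] := blue_copy_in_side I hf (cH i0 a).
have [cb sb] := blue_copy_in_side I hf (cH i0 b).
by case: (leqP (f a) (f b)) => _; rewrite ?ca ?sa ?cb ?sb !eqxx.
Qed.

(** The side holding the blue copy has at least [n] vertices and deficit at most [2 phi - 1], hence
    at least [phi n - 2 phi + 1] wasted edges besides the [m] edges of the copy. *)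
Lemma painter_game_over s comp side D n m :
  painter_inv s comp side D -> 0 < n -> game_over C_odd (Con n m) s ->
  (golden_ratio * INR n + INR m - 2 * golden_ratio + 1 <= INR (size s))%R.
Proof.
move=> I n0 [[H [oH cH]]|]; first by case: (no_red_odd_cycle I oH cH).
case=> H [[_ [eHn [cH mH]]] [f [injf hf]]]; subst n.
pose i0 := Ordinal n0.
have := @inv_deficit _ _ _ _ I (f i0) (side (f i0)) [seq f i | i in 'I_(fv H)].
rewrite size_map -cardE card_ord => hD.
have {}hD := hD (introT (injectiveP f) injf).
have /hD {}hD : forall x, x \in [seq f i | i in 'I_(fv H)] ->
    comp x = comp (f i0) /\ side x = side (f i0).
  by move=> x /imageP [i _ ->]; apply: blue_copy_in_side I hf (cH i0 i).
have [p1 _] := admissible_le (inv_admissible I (f i0)).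
have /leP/le_INR := blue_copy_size i0 I injf hf cH.
rewrite plus_INR; move/leP/le_INR: mH; lra.
Qed.

(** Rounds already played are counted by [size s], so [size s + t] stays constant through the
    induction on [t]. *)
Lemma painter_bound s comp side D n m t :
  painter_inv s comp side D -> 0 < n ->
  builder_wins_within C_odd (Con n m) t s ->
  (golden_ratio * INR n + INR m - 2 * golden_ratio + 1 <= INR (size s + t))%R.
Proof.
move=> I n0; elim: t s comp side D I => [|t IHt] s comp side D I /= [over|].
- by rewrite addn0; apply: painter_game_over I n0 over.
- by [].
- apply: Rle_trans (painter_game_over I n0 over) _.
  by apply/le_INR/leP/leq_addr.
- case=> u [v [_ [_ hc]]].
  have [c [comp' [side' [D' I']]]] := painter_move u v I.
  by have := IHt _ _ _ _ I' (hc c); rewrite /= addnS.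
Qed.

Theorem theorem1 (n m : nat) :
  1 <= n -> 1 <= m -> n - 1 <= m -> m <= 'C(n, 2) ->
  online_ramsey_ge C_odd (Con n m)
    (golden_ratio * INR n + INR m - 2 * golden_ratio + 1)%R.
Proof.
move=> n0 _ _ _ t; exact: painter_bound painter_inv_nil n0.
Qed.
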